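(* An arbitrary 3-tri-Leibniz algebra may not be induced from an averaging 3-Leibniz algebra. However, any 3-tri-Leibniz algebra can be embedded into an averaging 3-Leibniz algebra. More precisely, let $(\mathfrak{g},[\cdot,\cdot,\cdot]_\vdash,[\cdot,\cdot,\cdot]_\dashv,[\cdot,\cdot,\cdot]_\perp)$ be a 3-tri-Leibniz algebra, and let the 3-Leibniz algebra $\mathfrak{g}_{\mathrm{3Leib}}$ and its representation $(\mathfrak{g};\rho^l,\rho^m,\rho^r)$ be as defined in the context. Then $\mathfrak{g}_{\mathrm{3Leib}}\oplus\mathfrak{g}$ is a 3-Leibniz algebra with the bracket $$[(\overline{x},u),(\overline{y},v),(\overline{z},w)]_{\ltimes}=\big([\overline{x},\overline{y},\overline{z}],\ \rho^l(\overline{x},\overline{y},w)+\rho^m(\overline{x},v,\overline{z})+\rho^r(u,\overline{y},\overline{z})\big),$$ the map $$T:\mathfrak{g}_{\mathrm{3Leib}}\oplus\mathfrak{g}\to\mathfrak{g}_{\mathrm{3Leib}}\oplus\mathfrak{g},\qquad (\overline{x},y)\mapsto(\overline{y},0)$$ is an averaging operator on it, so that $(\mathfrak{g}_{\mathrm{3Leib}}\oplus\mathfrak{g},T)$ is an averaging 3-Leibniz algebra, and the inclusion $$i:\mathfrak{g}\to\mathfrak{g}_{\mathrm{3Leib}}\oplus\mathfrak{g},\qquad x\mapsto(0,x)$$ is an embedding of the 3-tri-Leibniz algebra $\mathfrak{g}$ into the averaging 3-Leibniz algebra $(\mathfrak{g}_{\mathrm{3Leib}}\oplus\mathfrak{g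},T)$.
   Context: All vector spaces and (multi)linear maps are over a field $\mathbb{K}$ of characteristic zero. 3-Leibniz algebra: a vector space with a trilinear bracket such that $[a,b,[x,y,z]]=[[a,b,x],y,z]+[x,[a,b,y],z]+[x,y,[a,b,z]]$ for all elements $a,b,x,y,z$. Representation of a 3-Leibniz algebra $\mathfrak{k}$: a vector space $V$ with trilinear maps $\rho^l:\mathfrak{k}\otimes\mathfrak{k}\otimes V\to V$, $\rho^m:\mathfrak{k}\otimes V\otimes\mathfrak{k}\to V$, $\rho^r:V\otimes\mathfrak{k}\otimes\mathfrak{k}\to V$ such that for all $x,y,z,a,b\in\mathfrak{k}$, $u\in V$: $\rho^l(a,b,\rho^l(x,y,u))=\rho^l([a,b,x],y,u)+\rho^l(x,[a,b,y],u)+\rho^l(x,y,\rho^l(a,b,u))$; $\rho^l(a,b,\rho^m(x,u,z))=\rho^m([a,b,x],u,z)+\rho^m(x,\rho^l(a,b,u),z)+\rho^m(x,u,[a,b,z])$; $\rho^l(a,b,\rho^r(u,y,z))=\rho^r(\rho^l(a,b,u),y,z)+\rho^r(u,[a,b,y],z)+\rho^r(u,y,[a,b,z])$; $\rho^m(a,u,[x,y,z])=\rho^r(\rho^m(a,u,x),y,z)+\rho^m(x,\rho^m(a,u,y),z)+\rho^l(x,y,\rho^m(a,u,z))$; $\rho^r(u,b,[x,y,z])=\rho^r(\rho^r(u,b,x),y,z)+\rho^m(x,\rho^r(u,b,y),z)+\rho^l(x,y,\rho^r(u,b,z))$. Averaging operator on a 3-Leibniz algebra $(\mathfrak{k},[\cdot,\cdot,\cdot]_{\mathfrak{k}})$: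 a linear map $T:\mathfrak{k}\to\mathfrak{k}$ with $[Tx,Ty,Tz]_{\mathfrak{k}}=T[Tx,Ty,z]_{\mathfrak{k}}=T[Tx,y,Tz]_{\mathfrak{k}}=T[x,Ty,Tz]_{\mathfrak{k}}$ for all $x,y,z\in\mathfrak{k}$; the pair $(\mathfrak{k},T)$ is then called an averaging 3-Leibniz algebra. It induces a 3-tri-Leibniz algebra structure on $\mathfrak{k}$ by $[x,y,z]_{\vdash}^T=[Tx,Ty,z]_{\mathfrak{k}}$, $[x,y,z]_{\perp}^T=[Tx,y,Tz]_{\mathfrak{k}}$, $[x,y,z]_{\dashv}^T=[x,Ty,Tz]_{\mathfrak{k}}$. An embedding of a 3-tri-Leibniz algebra $\mathfrak{g}$ into $(\mathfrak{k},T)$ is an injective linear map $i:\mathfrak{g}\to\mathfrak{k}$ with $i([x,y,z]_{\triangle})=[i(x),i(y),i(z)]_{\triangle}^T$ for all $x,y,z\in\mathfrak{g}$, $\triangle\in\{\vdash,\dashv,\perp\}$. 3-tri-Leibniz algebra: a vector space with three trilinear brackets $[\cdot,\cdot,\cdot]_{\dashv},[\cdot,\cdot,\cdot]_{\perp},[\cdot,\cdot,\cdot]_{\vdash}$ such that for all elements $x,y,z,a,b$ and all $\triangle\in\{\vdash,\dashv,\perp\}$: (i) $[a,b,[x,y,z]_{\triangle}]_{\dashv}=[[a,b,x]_{\dashv},y,z]_{\dashv}+[x,[a,b,y]_{\dashv},z]_{\perp}+[x,y,[a,b,z]_{\dashv}]_{\vdash}$; (ii) $[a,b,[x,y,z]_{\dashv}]_{\vdash}=[[a,b,x]_{\vdash},y,z]_{\dashv}+[x,[a,b,y]_{\triangle},z]_{\dashv}+[x,y,[a,b,z]_{\triangle}]_{\dashv}$;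 (iii) $[a,b,[x,y,z]_{\vdash}]_{\vdash}=[[a,b,x]_{\triangle},y,z]_{\vdash}+[x,[a,b,y]_{\triangle},z]_{\vdash}+[x,y,[a,b,z]_{\vdash}]_{\vdash}$; (iv) $[a,b,[x,y,z]_{\perp}]_{\vdash}=[[a,b,x]_{\triangle},y,z]_{\perp}+[x,[a,b,y]_{\vdash},z]_{\perp}+[x,y,[a,b,z]_{\triangle}]_{\perp}$; (v) $[a,b,[x,y,z]_{\triangle}]_{\perp}=[[a,b,x]_{\perp},y,z]_{\dashv}+[x,[a,b,y]_{\perp},z]_{\perp}+[x,y,[a,b,z]_{\perp}]_{\vdash}$. For a 3-tri-Leibniz algebra $\mathfrak{g}$, let $I_{\mathfrak{g}}$ be the linear span of all elements $[x,y,z]_\vdash-[x,y,z]_\dashv$, $[x,y,z]_\dashv-[x,y,z]_\perp$, $[x,y,z]_\vdash-[x,y,z]_\perp$ with $x,y,z\in\mathfrak{g}$. It is an ideal, and the quotient $\mathfrak{g}_{\mathrm{3Leib}}=\mathfrak{g}/I_{\mathfrak{g}}$ (class of $x$ denoted $\overline{x}$) carries the 3-Leibniz algebra structure $[\overline{x},\overline{y},\overline{z}]=\overline{[x,y,z]_\vdash}=\overline{[x,y,z]_\dashv}=\overline{[x,y,z]_\perp}$. The representation of $\mathfrak{g}_{\mathrm{3Leib}}$ on the vector space $\mathfrak{g}$ is defined by $\rho^l(\overline{x},\overline{y},z)=[x,y,z]_\vdash$, $\rho^m(\overline{x},z,\overline{y})=[x,z,y]_\perp$, $\rho^r(z,\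overline{x},\overline{y})=[z,x,y]_\dashv$.
   Formalization: In axioms (ii)-(iv) of a 3-tri-Leibniz algebra the two occurrences of the symbol △ range over the three brackets independently; with one common △ in (iii), the map ρ^l need not be well defined on the quotient and the embedding can fail. *)

(* Defs.v *)
From HB Require Import structures.
From mathcomp Require Import all_boot all_algebra.
From mathcomp Require Import boolp.

Set Implicit Arguments.
Unset Strict Implicit.
Unset Printing Implicit Defensive.

Import GRing.Theory.
Local Open Scope ring_scope.
Local Open Scope quotient_scope.

Definition trilinear (K : fieldType) (A B C D : lmodType K)
    (f : A -> B -> C -> D) : Prop :=
  [/\ forall y z, linear (fun x => f x y z),
      forall x z, linear (fun y => f x y z) &
      forall x y, linear (fun z => f x y z)].

Definition is_leibniz3 (K : fieldType) (k : lmodType K)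
    (br : k -> k -> k -> k) : Prop :=
  trilinear br /\
  forall a b x y z,
    br a b (br x y z) = br (br a b x) y z + br x (br a b y) z + br x y (br a b z).

Record is_representation (K : fieldType) (k V : lmodType K)
    (br : k -> k -> k -> k)
    (rl : k -> k -> V -> V) (rm : k -> V -> k -> V) (rr : V -> k -> k -> V) :
    Prop := IsRepresentation {
  rep_linl : trilinear rl;
  rep_linm : trilinear rm;
  rep_linr : trilinear rr;
  rep_ll : forall a b x y u,
    rl a b (rl x y u) = rl (br a b x) y u + rl x (br a b y) u + rl x y (rl a b u);
  rep_lm : forall a b x u z,
    rl a b (rm x u z) = rm (br a b x) u z + rm x (rl a b u) z + rm x u (br a b z);
  rep_lr : forall a b u y z,
    rl a b (rr u y z) = rr (rl a b u) y z + rr u (br a b y) z + rr u y (br a b z);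
  rep_m : forall a u x y z,
    rm a u (br x y z) = rr (rm a u x) y z + rm x (rm a u y) z + rl x y (rm a u z);
  rep_r : forall u b x y z,
    rr u b (br x y z) = rr (rr u b x) y z + rm x (rr u b y) z + rl x y (rr u b z)
}.

Definition semidirect_br (K : fieldType) (k V : lmodType K)
    (br : k -> k -> k -> k)
    (rl : k -> k -> V -> V) (rm : k -> V -> k -> V) (rr : V -> k -> k -> V)
    (p q r : (k * V)%type) : (k * V)%type :=
  (br p.1 q.1 r.1, rl p.1 q.1 r.2 + rm p.1 q.2 r.1 + rr p.2 q.1 r.1).

Definition averaging_operator (K : fieldType) (k : lmodType K)
    (br : k -> k -> k -> k) (T : k -> k) : Prop :=
  linear T /\
  forall x y z,
    [/\ br (T x) (T y) (T z) = T (br (T x) (T y) z),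
        br (T x) (T y) (T z) = T (br (T x) y (T z)) &
        br (T x) (T y) (T z) = T (br x (T y) (T z))].

Definition is_averaging_leibniz3 (K : fieldType) (k : lmodType K)
    (br : k -> k -> k -> k) (T : k -> k) : Prop :=
  is_leibniz3 br /\ averaging_operator br T.

Inductive tri := Vdash | Perp | Dashv.

Definition tri_op (V : Type) := tri -> V -> V -> V -> V.

(* The symbol that is free in each axiom ranges over the three brackets       *)
(* independently at each of its occurrences, hence the two variables s and t. *)
(* With s = t imposed, tri_vdash would not make rho_l below well defined:     *)
(* let [e,e,e]_Dashv = p, [p,e,e]_Vdash = q, [e,p,e]_Vdash = - q and all      *)
(* other brackets of the basis (e, p, q) vanish. Then p lies in the span      *)
(* defining tri_ideal although [p,e,e]_Vdash <> 0, and this algebra does not  *)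
(* embed into any averaging 3-Leibniz algebra.                                *)
Record is_tri_leibniz3 (K : fieldType) (V : lmodType K) (br : tri_op V) :
    Prop := IsTriLeibniz3 {
  tri_lin : forall t, trilinear (br t);
  tri_dashv : forall t a b x y z,
    br Dashv a b (br t x y z) =
      br Dashv (br Dashv a b x) y z + br Perp x (br Dashv a b y) z
      + br Vdash x y (br Dashv a b z);
  tri_vdash_dashv : forall s t a b x y z,
    br Vdash a b (br Dashv x y z) =
      br Dashv (br Vdash a b x) y z + br Dashv x (br s a b y) z
      + br Dashv x y (br t a b z);
  tri_vdash : forall s t a b x y z,
    br Vdash a b (br Vdash x y z) =
      br Vdash (br s a b x) y z + br Vdash x (br t a b y) z
      + br Vdash x y (br Vdash a b z);
  tri_vdash_perp : forall s t a b x y z,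
    br Vdash a b (br Perp x y z) =
      br Perp (br s a b x) y z + br Perp x (br Vdash a b y) z
      + br Perp x y (br t a b z);
  tri_perp : forall t a b x y z,
    br Perp a b (br t x y z) =
      br Dashv (br Perp a b x) y z + br Perp x (br Perp a b y) z
      + br Vdash x y (br Perp a b z)
}.

Definition induced_tri (k : Type) (br : k -> k -> k -> k) (T : k -> k) :
    tri_op k :=
  fun t x y z =>
    match t with
    | Vdash => br (T x) (T y) z
    | Perp => br (T x) y (T z)
    | Dashv => br x (T y) (T z)
    end.

Definition induced_from_averaging (K : fieldType) (V : lmodType K)
    (br : tri_op V) : Prop :=
  exists (brk : V -> V -> V -> V) (T : V -> V),
    is_averaging_leibniz3 brk T /\
    forall t x y z, br t x y z = induced_tri brk T t x y z.

Definition averaging_embedding (K : fieldType) (g k : lmodType K)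
    (br : tri_op g) (brk : k -> k -> k -> k) (T : k -> k) (i : g -> k) : Prop :=
  [/\ linear i, injective i &
      forall t x y z, i (br t x y z) = induced_tri brk T t (i x) (i y) (i z)].

Definition in_span (K : fieldType) (V : lmodType K) (S : V -> Prop) (v : V) :
    Prop :=
  exists (n : nat) (c : 'I_n -> K) (x : 'I_n -> V),
    (forall i, S (x i)) /\ v = \sum_(i < n) c i *: x i.

Lemma in_span_submod (K : fieldType) (V : lmodType K) (S : V -> Prop) :
  submod_closed (fun v => `[< in_span S v >]).
Proof.
split.
  apply/asboolP; exists 0%N, (fun _ => 0), (fun _ => 0).
  by split=> [[]|] //; rewrite big_ord0.
move=> a u v /asboolP[n [c [x [Sx ->]]]] /asboolP[m [d [y [Sy ->]]]].
apply/asboolP; exists (n + m)%N.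
exists (fun i => match split i with inl j => a * c j | inr j => d j end).
exists (fun i => match split i with inl j => x j | inr j => y j end).
split=> [i|]; first by case: (split i).
rewrite big_split_ord /= scaler_sumr; congr (_ + _); apply: eq_bigr => i _.
  by rewrite (unsplitK (inl i)) scalerA.
by rewrite (unsplitK (inr i)).
Qed.

Definition tri_ideal (K : fieldType) (V : lmodType K) (br : tri_op V) (v : V) :
    bool :=
  `[< in_span (fun d => exists x y z,
        [\/ d = br Vdash x y z - br Dashv x y z,
            d = br Dashv x y z - br Perp x y z |
            d = br Vdash x y z - br Perp x y z]) v >].

HB.instance Definition _ (K : fieldType) (V : lmodType K) (br : tri_op V) :=
  GRing.isSubmodClosed.Build K V (tri_ideal br) (in_span_submod _).

Definition tri_ideal_zmod (K : fieldType) (V : lmodType K) (br : tri_op V) :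
    zmodClosed V := GRing.ZmodClosed.clone V (tri_ideal br) _.

(* Quotient.quot only provides the additive group structure of the quotient;  *)
(* the scaling is added below.                                                *)
Definition g3Leib (K : fieldType) (V : lmodType K) (br : tri_op V) : Type :=
  Quotient.quot (tri_ideal_zmod br).

HB.instance Definition _ (K : fieldType) (V : lmodType K) (br : tri_op V) :=
  GRing.Zmodule.on (g3Leib br).

Definition cls (K : fieldType) (V : lmodType K) (br : tri_op V) (x : V) :
    g3Leib br := \pi_(Quotient.quot (tri_ideal_zmod br)) x.

Definition rep (K : fieldType) (V : lmodType K) (br : tri_op V)
    (x : g3Leib br) : V := @repr V (Quotient.quot (tri_ideal_zmod br)) x.

Lemma repK (K : fieldType) (V : lmodType K) (br : tri_op V) :
  cancel (@rep K V br) (@cls K V br).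
Proof. by move=> x; exact: (@reprK V (Quotient.quot (tri_ideal_zmod br))). Qed.

Lemma clsP (K : fieldType) (V : lmodType K) (br : tri_op V) (x y : V) :
  cls br x = cls br y <-> x - y \in tri_ideal br.
Proof. by rewrite Quotient.idealrBE; split=> [/eqP|/eqP]. Qed.

Lemma clsD (K : fieldType) (V : lmodType K) (br : tri_op V) :
  {morph cls br : x y / x + y}.
Proof. by move=> x y; exact: (raddfD (\pi_(Quotient.quot (tri_ideal_zmod br)))). Qed.

Definition g3Leib_scale (K : fieldType) (V : lmodType K) (br : tri_op V)
    (a : K) (x : g3Leib br) : g3Leib br := cls br (a *: rep x).

Lemma clsZ (K : fieldType) (V : lmodType K) (br : tri_op V) (a : K) (x : V) :
  cls br (a *: x) = g3Leib_scale a (cls br x).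
Proof. by apply/clsP; rewrite -scalerBr rpredZ //; apply/clsP; rewrite repK. Qed.

Lemma g3Leib_scaleA (K : fieldType) (V : lmodType K) (br : tri_op V) (a b : K)
    (x : g3Leib br) :
  g3Leib_scale a (g3Leib_scale b x) = g3Leib_scale (a * b) x.
Proof. by rewrite -[x]repK -!clsZ scalerA. Qed.

Lemma g3Leib_scale1 (K : fieldType) (V : lmodType K) (br : tri_op V) :
  left_id 1 (@g3Leib_scale K V br).
Proof. by move=> x; rewrite -[x]repK -clsZ scale1r. Qed.

Lemma g3Leib_scaleDr (K : fieldType) (V : lmodType K) (br : tri_op V) :
  right_distributive (@g3Leib_scale K V br) +%R.
Proof.
by move=> a x y; rewrite -[x]repK -[y]repK -clsD -!clsZ -clsD scalerDr.
Qed.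

Lemma g3Leib_scaleDl (K : fieldType) (V : lmodType K) (br : tri_op V)
    (x : g3Leib br) :
  {morph (@g3Leib_scale K V br)^~ x : a b / a + b}.
Proof. by move=> a b; rewrite -[x]repK -!clsZ -clsD scalerDl. Qed.

HB.instance Definition _ (K : fieldType) (V : lmodType K) (br : tri_op V) :=
  GRing.Zmodule_isLmodule.Build K (g3Leib br)
    (@g3Leib_scaleA K V br) (@g3Leib_scale1 K V br) (@g3Leib_scaleDr K V br)
    (@g3Leib_scaleDl K V br).

Lemma cls_linear (K : fieldType) (V : lmodType K) (br : tri_op V) :
  linear (cls br).
Proof. by move=> a x y; rewrite clsD clsZ. Qed.

HB.instance Definition _ (K : fieldType) (V : lmodType K) (br : tri_op V) :=
  GRing.isLinear.Build K V (g3Leib br) _ (cls br) (@cls_linear K V br).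

Lemma linear_0 (K : fieldType) (V W : lmodType K) (f : V -> W) :
  linear f -> f 0 = 0.
Proof. by move=> lf; have := lf (-1) 0 0; rewrite scaler0 addr0 scaleN1r addNr. Qed.

Lemma linear_B (K : fieldType) (V W : lmodType K) (f : V -> W) x y :
  linear f -> f (x - y) = f x - f y.
Proof. by move=> lf; rewrite addrC -scaleN1r lf scaleN1r addrC. Qed.

Lemma linear_sum0 (K : fieldType) (V W : lmodType K) (f : V -> W) n
    (c : 'I_n -> K) (x : 'I_n -> V) :
  linear f -> (forall i, f (x i) = 0) -> f (\sum_(i < n) c i *: x i) = 0.
Proof.
move=> lf f0; elim/big_ind: _ => [|u v fu fv|i _]; first exact: linear_0.
  by rewrite -[u]scale1r lf fu fv scaler0 addr0.
by rewrite -[_ *: _]addr0 lf f0 scaler0 linear_0 // addr0.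
Qed.

Lemma tri_ideal_gen (K : fieldType) (V : lmodType K) (br : tri_op V) s t x y z :
  br s x y z - br t x y z \in tri_ideal br.
Proof.
have gen d : (exists x y z,
    [\/ d = br Vdash x y z - br Dashv x y z,
        d = br Dashv x y z - br Perp x y z |
        d = br Vdash x y z - br Perp x y z]) -> d \in tri_ideal br.
  move=> hd; apply/asboolP; exists 1%N, (fun _ => 1), (fun _ => d).
  by split=> // ; rewrite big_ord1 scale1r.
have vd : br Vdash x y z - br Dashv x y z \in tri_ideal br.
  by apply: gen; exists x, y, z; constructor 1.
have dp : br Dashv x y z - br Perp x y z \in tri_ideal br.
  by apply: gen; exists x, y, z; constructor 2.
have vp : br Vdash x y z - br Perp x y z \in tri_ideal br.
  by apply: gen; exists x, y, z; constructor 3.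
by case: s t => [] [] //; rewrite ?subrr ?rpred0 // -opprB rpredN.
Qed.

Lemma tri_ideal_linear0 (K : fieldType) (V W : lmodType K) (br : tri_op V)
    (f : V -> W) u :
  linear f -> (forall s t x y z, f (br s x y z) = f (br t x y z)) ->
  u \in tri_ideal br -> f u = 0.
Proof.
move=> lf feq /asboolP[n [c [x [Sx ->]]]]; apply: linear_sum0 => // i.
have [a [b [d [] ->]]] := Sx i; rewrite linear_B //; apply/eqP;
  rewrite subr_eq0; apply/eqP; exact: feq.
Qed.

Lemma tri_ideal_vdash1 (K : fieldType) (V : lmodType K) (br : tri_op V) u y z :
  is_tri_leibniz3 br -> u \in tri_ideal br -> br Vdash u y z = 0.
Proof.
move=> hb; have [l1 _ _] := tri_lin hb Vdash.
apply: (tri_ideal_linear0 (l1 y z)) => s t a b x.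
have := tri_vdash hb s Vdash a b x y z.
by rewrite (tri_vdash hb t Vdash) => /addIr /addIr.
Qed.

Lemma tri_ideal_vdash2 (K : fieldType) (V : lmodType K) (br : tri_op V) x u z :
  is_tri_leibniz3 br -> u \in tri_ideal br -> br Vdash x u z = 0.
Proof.
move=> hb; have [_ l2 _] := tri_lin hb Vdash.
apply: (tri_ideal_linear0 (l2 x z)) => s t a b y.
have := tri_vdash hb Vdash s a b x y z.
by rewrite (tri_vdash hb Vdash t) => /addIr /addrI.
Qed.

Lemma tri_ideal_perp1 (K : fieldType) (V : lmodType K) (br : tri_op V) u y z :
  is_tri_leibniz3 br -> u \in tri_ideal br -> br Perp u y z = 0.
Proof.
move=> hb; have [l1 _ _] := tri_lin hb Perp.
apply: (tri_ideal_linear0 (l1 y z)) => s t a b x.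
have := tri_vdash_perp hb s Vdash a b x y z.
by rewrite (tri_vdash_perp hb t Vdash) => /addIr /addIr.
Qed.

Lemma tri_ideal_perp3 (K : fieldType) (V : lmodType K) (br : tri_op V) x y u :
  is_tri_leibniz3 br -> u \in tri_ideal br -> br Perp x y u = 0.
Proof.
move=> hb; have [_ _ l3] := tri_lin hb Perp.
apply: (tri_ideal_linear0 (l3 x y)) => s t a b z.
by rewrite (tri_perp hb s) (tri_perp hb t).
Qed.

Lemma tri_ideal_dashv2 (K : fieldType) (V : lmodType K) (br : tri_op V) x u z :
  is_tri_leibniz3 br -> u \in tri_ideal br -> br Dashv x u z = 0.
Proof.
move=> hb; have [_ l2 _] := tri_lin hb Dashv.
apply: (tri_ideal_linear0 (l2 x z)) => s t a b y.
have := tri_vdash_dashv hb s Vdash a b x y z.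
by rewrite (tri_vdash_dashv hb t Vdash) => /addIr /addrI.
Qed.

Lemma tri_ideal_dashv3 (K : fieldType) (V : lmodType K) (br : tri_op V) x y u :
  is_tri_leibniz3 br -> u \in tri_ideal br -> br Dashv x y u = 0.
Proof.
move=> hb; have [_ _ l3] := tri_lin hb Dashv.
apply: (tri_ideal_linear0 (l3 x y)) => s t a b z.
by rewrite (tri_dashv hb s) (tri_dashv hb t).
Qed.

Lemma rep_cls_ideal (K : fieldType) (V : lmodType K) (br : tri_op V) (x : V) :
  rep (cls br x) - x \in tri_ideal br.
Proof. by apply/clsP; rewrite repK. Qed.

(* The bracket of g3Leib and the maps rho_l, rho_m, rho_r are computed on     *)
(* representatives; g3Leib_brE, rho_lE, rho_mE and rho_rE show that the       *)
(* choice of representatives (and of bracket, for g3Leib_br) is immaterial.   *)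
Definition g3Leib_br (K : fieldType) (V : lmodType K) (br : tri_op V)
    (x y z : g3Leib br) : g3Leib br :=
  cls br (br Vdash (rep x) (rep y) (rep z)).

Definition rho_l (K : fieldType) (V : lmodType K) (br : tri_op V)
    (x y : g3Leib br) (z : V) : V := br Vdash (rep x) (rep y) z.

Definition rho_m (K : fieldType) (V : lmodType K) (br : tri_op V)
    (x : g3Leib br) (z : V) (y : g3Leib br) : V := br Perp (rep x) z (rep y).

Definition rho_r (K : fieldType) (V : lmodType K) (br : tri_op V)
    (z : V) (x y : g3Leib br) : V := br Dashv z (rep x) (rep y).

Lemma rho_lE (K : fieldType) (V : lmodType K) (br : tri_op V) (x y z : V) :
  is_tri_leibniz3 br -> rho_l (cls br x) (cls br y) z = br Vdash x y z.
Proof.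
move=> hb; have [l1 l2 _] := tri_lin hb Vdash; rewrite /rho_l.
transitivity (br Vdash x (rep (cls br y)) z); apply/eqP; rewrite -subr_eq0.
  by rewrite -(linear_B _ _ (l1 _ z)) tri_ideal_vdash1 ?rep_cls_ideal.
by rewrite -(linear_B _ _ (l2 x z)) tri_ideal_vdash2 ?rep_cls_ideal.
Qed.

Lemma rho_mE (K : fieldType) (V : lmodType K) (br : tri_op V) (x y z : V) :
  is_tri_leibniz3 br -> rho_m (cls br x) z (cls br y) = br Perp x z y.
Proof.
move=> hb; have [l1 _ l3] := tri_lin hb Perp; rewrite /rho_m.
transitivity (br Perp x z (rep (cls br y))); apply/eqP; rewrite -subr_eq0.
  by rewrite -(linear_B _ _ (l1 z _)) tri_ideal_perp1 ?rep_cls_ideal.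
by rewrite -(linear_B _ _ (l3 x z)) tri_ideal_perp3 ?rep_cls_ideal.
Qed.

Lemma rho_rE (K : fieldType) (V : lmodType K) (br : tri_op V) (x y z : V) :
  is_tri_leibniz3 br -> rho_r z (cls br x) (cls br y) = br Dashv z x y.
Proof.
move=> hb; have [_ l2 l3] := tri_lin hb Dashv; rewrite /rho_r.
transitivity (br Dashv z x (rep (cls br y))); apply/eqP; rewrite -subr_eq0.
  by rewrite -(linear_B _ _ (l2 z _)) tri_ideal_dashv2 ?rep_cls_ideal.
by rewrite -(linear_B _ _ (l3 z x)) tri_ideal_dashv3 ?rep_cls_ideal.
Qed.

Lemma cls_tri (K : fieldType) (V : lmodType K) (br : tri_op V) s t x y z :
  cls br (br s x y z) = cls br (br t x y z).
Proof. by apply/clsP; exact: tri_ideal_gen. Qed.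

Lemma g3Leib_brE (K : fieldType) (V : lmodType K) (br : tri_op V) t (x y z : V) :
  is_tri_leibniz3 br ->
  g3Leib_br (cls br x) (cls br y) (cls br z) = cls br (br t x y z).
Proof.
move=> hb; have [_ _ l3] := tri_lin hb Dashv.
rewrite /g3Leib_br -/(rho_l _ _ _) rho_lE // (cls_tri br _ Dashv) (cls_tri br t Dashv).
congr (cls br _); apply/eqP; rewrite -subr_eq0.
by rewrite -(linear_B _ _ (l3 x y)) tri_ideal_dashv3 ?rep_cls_ideal.
Qed.

Lemma g3Leib_leibniz3 (K : fieldType) (V : lmodType K) (br : tri_op V) :
  is_tri_leibniz3 br -> is_leibniz3 (@g3Leib_br K V br).
Proof.
move=> hb; have brE x y z := g3Leib_brE Vdash x y z hb.
have [l1 l2 l3] := tri_lin hb Vdash.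
split; first split=> y z a u v.
- rewrite -[y]repK -[z]repK -[u]repK -[v]repK -cls_linear.
  by rewrite !brE l1 cls_linear.
- rewrite -[y]repK -[z]repK -[u]repK -[v]repK -cls_linear.
  by rewrite !brE l2 cls_linear.
- rewrite -[y]repK -[z]repK -[u]repK -[v]repK -cls_linear.
  by rewrite !brE l3 cls_linear.
move=> a b x y z; rewrite -[a]repK -[b]repK -[x]repK -[y]repK -[z]repK.
by rewrite !brE (tri_vdash hb Vdash Vdash) !clsD.
Qed.

Lemma g3Leib_representation (K : fieldType) (V : lmodType K) (br : tri_op V) :
  is_tri_leibniz3 br ->
  is_representation (@g3Leib_br K V br)
    (@rho_l K V br) (@rho_m K V br) (@rho_r K V br).
Proof.
move=> hb; have brE x y z := g3Leib_brE Vdash x y z hb.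
have lE x y z := rho_lE x y z hb.
have mE x y z := rho_mE x y z hb.
have rE x y z := rho_rE x y z hb.
have [ll1 ll2 ll3] := tri_lin hb Vdash.
have [lm1 lm2 lm3] := tri_lin hb Perp.
have [lr1 lr2 lr3] := tri_lin hb Dashv.
split; first [split=> y z c u v | move=> a b x y z].
- by rewrite -[y]repK -[u]repK -[v]repK -cls_linear !lE ll1.
- by rewrite -[y]repK -[u]repK -[v]repK -cls_linear !lE ll2.
- by rewrite -[y]repK -[z]repK !lE ll3.
- by rewrite -[z]repK -[u]repK -[v]repK -cls_linear !mE lm1.
- by rewrite -[y]repK -[z]repK !mE lm2.
- by rewrite -[y]repK -[u]repK -[v]repK -cls_linear !mE lm3.
- by rewrite -[y]repK -[z]repK !rE lr1.
- by rewrite -[z]repK -[u]repK -[v]repK -cls_linear !rE lr2.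
- by rewrite -[z]repK -[u]repK -[v]repK -cls_linear !rE lr3.
- rewrite -[a]repK -[b]repK -[x]repK -[y]repK !brE !lE.
  exact: tri_vdash.
- rewrite -[a]repK -[b]repK -[x]repK -[z]repK !brE !(lE, mE).
  exact: tri_vdash_perp.
- rewrite -[a]repK -[b]repK -[y]repK -[z]repK !brE !(lE, rE).
  exact: tri_vdash_dashv.
- rewrite -[a]repK -[x]repK -[y]repK -[z]repK !brE !(lE, mE, rE).
  exact: tri_perp.
- rewrite -[b]repK -[x]repK -[y]repK -[z]repK !brE !(lE, mE, rE).
  exact: tri_dashv.
Qed.

Definition g3Leib_semidirect_br (K : fieldType) (V : lmodType K)
    (br : tri_op V) :
    (g3Leib br * V)%type -> (g3Leib br * V)%type -> (g3Leib br * V)%type ->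
    (g3Leib br * V)%type :=
  semidirect_br (@g3Leib_br K V br)
    (@rho_l K V br) (@rho_m K V br) (@rho_r K V br).

Definition g3Leib_avg (K : fieldType) (V : lmodType K) (br : tri_op V)
    (p : (g3Leib br * V)%type) : (g3Leib br * V)%type := (cls br p.2, 0).

Definition g3Leib_incl (K : fieldType) (V : lmodType K) (br : tri_op V)
    (x : V) : (g3Leib br * V)%type := (0, x).

(* Main.v *)
Require Import Defs.
From mathcomp Require Import all_boot all_algebra.
From mathcomp Require Import ssrAC ring.

(** For the embedding, a representation of a 3-Leibniz algebra is exactly what
    makes the semidirect product a 3-Leibniz algebra
    ([semidirect_leibniz3]): the component of the fundamental identity in the
    module is the sum of the five axioms of a representation, one for each slot
    that holds the element of the module.  The map T moves g into the
    quotient 3-Leibniz algebra, so two arguments in the image of T act on the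
    third one through the three actions, which are the three brackets of g by
    definition.  This yields both the embedding ([g3Leib_embedding]) and, once
    classes are taken, the averaging property ([g3Leib_averaging]).

    For the algebra that is not induced, take the basis (e, p) and let the only
    nonzero brackets of basis elements be [e,e,e] = p under Vdash and Dashv
    ([nilp_br]).  All iterated
    brackets vanish, so the axioms hold trivially.  Suppose that a bracket and
    an averaging operator T on the same plane induce this structure, and put
    f = T e.  Then [f,f,e] = p = [e,f,f], [f,e,f] = 0 and
    [f,f,f] = T [f,e,f] = 0, and the fundamental identity applied to e and f
    is contradictory as soon as 2 and 3 are nonzero ([nilp_not_induced]). *)

Set Implicit Arguments.
Unset Strict Implicit.
Unset Printing Implicit Defensive.

Import GRing.Theory.
Local Open Scope ring_scope.

Lemma linear_D (K : fieldType) (V W : lmodType K) (f : V -> W) :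
  linear f -> {morph f : x y / x + y}.
Proof. by move=> lf x y; rewrite -{1}[x]scale1r lf scale1r. Qed.

Lemma linear_Z (K : fieldType) (V W : lmodType K) (f : V -> W) (a : K) x :
  linear f -> f (a *: x) = a *: f x.
Proof. by move=> lf; rewrite -[a *: x]addr0 lf (linear_0 lf) addr0. Qed.

(** * Trilinear maps *)

Section Trilinear.
Variables (K : fieldType) (A B C D : lmodType K) (f : A -> B -> C -> D).
Hypothesis lf : trilinear f.

Lemma trilinear_D1 x x' y z : f (x + x') y z = f x y z + f x' y z.
Proof. by have [l _ _] := lf; rewrite (linear_D (l y z)). Qed.
Lemma trilinear_D2 x y y' z : f x (y + y') z = f x y z + f x y' z.
Proof. by have [_ l _] := lf; rewrite (linear_D (l x z)). Qed.
Lemma trilinear_D3 x y z z' : f x y (z + z') = f x y z + f x y z'.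
Proof. by have [_ _ l] := lf; rewrite (linear_D (l x y)). Qed.
Lemma trilinear_Z1 a x y z : f (a *: x) y z = a *: f x y z.
Proof. by have [l _ _] := lf; rewrite (linear_Z _ _ (l y z)). Qed.
Lemma trilinear_Z2 a x y z : f x (a *: y) z = a *: f x y z.
Proof. by have [_ l _] := lf; rewrite (linear_Z _ _ (l x z)). Qed.
Lemma trilinear_Z3 a x y z : f x y (a *: z) = a *: f x y z.
Proof. by have [_ _ l] := lf; rewrite (linear_Z _ _ (l x y)). Qed.
Lemma trilinear_01 y z : f 0 y z = 0.
Proof. by rewrite -(scale0r 0) trilinear_Z1 scale0r. Qed.
Lemma trilinear_02 x z : f x 0 z = 0.
Proof. by rewrite -(scale0r 0) trilinear_Z2 scale0r. Qed.
Lemma trilinear_03 x y : f x y 0 = 0.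
Proof. by rewrite -(scale0r 0) trilinear_Z3 scale0r. Qed.

End Trilinear.

(** * Semidirect products *)

(** In the module component of the fundamental identity for (a,s), (b,t),
    (x,u), (y,v), (z,w), every term is linear in exactly one of s, t, u, v, w,
    and the terms in each of these five variables cancel by one axiom of the
    representation. *)
Lemma semidirect_leibniz3 (K : fieldType) (k V : lmodType K)
    (br : k -> k -> k -> k)
    (rl : k -> k -> V -> V) (rm : k -> V -> k -> V) (rr : V -> k -> k -> V) :
  is_leibniz3 br -> is_representation br rl rm rr ->
  is_leibniz3 (semidirect_br br rl rm rr).
Proof.
move=> [lb jac] [ll lm lr jl jlm jlr jm jr]; split.
  split=> p q c [x u] [x' u']; congr pair => /=.
  - by rewrite (trilinear_D1 lb) (trilinear_Z1 lb).
  - rewrite (trilinear_D1 ll) (trilinear_Z1 ll) (trilinear_D1 lm).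
    rewrite (trilinear_Z1 lm) (trilinear_D1 lr) (trilinear_Z1 lr) !scalerDr.
    by rewrite (AC (2*2*2) ((1*3*5)*(2*4*6))).
  - by rewrite (trilinear_D2 lb) (trilinear_Z2 lb).
  - rewrite (trilinear_D2 ll) (trilinear_Z2 ll) (trilinear_D2 lm).
    rewrite (trilinear_Z2 lm) (trilinear_D2 lr) (trilinear_Z2 lr) !scalerDr.
    by rewrite (AC (2*2*2) ((1*3*5)*(2*4*6))).
  - by rewrite (trilinear_D3 lb) (trilinear_Z3 lb).
  - rewrite (trilinear_D3 ll) (trilinear_Z3 ll) (trilinear_D3 lm).
    rewrite (trilinear_Z3 lm) (trilinear_D3 lr) (trilinear_Z3 lr) !scalerDr.
    by rewrite (AC (2*2*2) ((1*3*5)*(2*4*6))).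
move=> [a s] [b t] [x u] [y v] [z w]; congr pair => /=; first exact: jac.
rewrite !(trilinear_D3 ll) jl jlm jlr (jm a) (jr s).
rewrite !(trilinear_D2 lm) !(trilinear_D1 lr).
(* The left side lists the terms by the variable w, v, u, t, s that they
   contain, the right side by the slot to which (a,s), (b,t) is applied. *)
by rewrite (AC ((3*3*3)*3*3)
  ((1*4*((7*10)*13))*(2*((5*11)*14)*8)*(((3*12)*15)*6*9))).
Qed.

(** * The averaging algebra of a 3-tri-Leibniz algebra *)

Section Embedding.
Variables (K : fieldType) (V : lmodType K) (br : tri_op V).
Hypothesis hb : is_tri_leibniz3 br.

Lemma g3Leib_semidirect_leibniz3 : is_leibniz3 (@g3Leib_semidirect_br K V br).
Proof.
exact: semidirect_leibniz3 (g3Leib_leibniz3 hb) (g3Leib_representation hb).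
Qed.

(** All three brackets of g have the same class in the quotient, and this
    common class is the bracket of the classes. *)
Lemma g3Leib_averaging :
  averaging_operator (@g3Leib_semidirect_br K V br) (@g3Leib_avg K V br).
Proof.
have [ll lm lr _ _ _ _ _] := g3Leib_representation hb.
split=> [c [x u] [y v]|[x u] [y v] [z w]].
  by congr pair => /=; rewrite ?clsD ?clsZ // scaler0 addr0.
rewrite /g3Leib_avg /g3Leib_semidirect_br /semidirect_br /=.
rewrite !(trilinear_03 ll) !(trilinear_02 lm) !(trilinear_01 lr) !addr0 !add0r.
by split; congr pair; rewrite ?rho_lE ?rho_mE ?rho_rE // -g3Leib_brE.
Qed.

Lemma g3Leib_embedding :
  averaging_embedding br (@g3Leib_semidirect_br K V br)
    (@g3Leib_avg K V br) (g3Leib_incl br).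
Proof.
have [[lb _] [ll lm lr _ _ _ _ _]] :=
  (g3Leib_leibniz3 hb, g3Leib_representation hb).
split=> [c x y|x y [] //|t x y z].
  by congr pair => /=; rewrite scaler0 addr0.
case: t; congr pair => /=.
- by rewrite (trilinear_03 lb).
- by rewrite rho_lE // (trilinear_02 lm) (trilinear_01 lr) !addr0.
- by rewrite (trilinear_02 lb).
- by rewrite rho_mE // (trilinear_03 ll) (trilinear_01 lr) addr0 add0r.
- by rewrite (trilinear_01 lb).
- by rewrite rho_rE // (trilinear_03 ll) (trilinear_02 lm) !add0r.
Qed.

End Embedding.

(** * A 3-tri-Leibniz algebra that is not induced *)

Definition nilp_br (K : fieldType) : tri_op (K^o * K^o)%type :=
  fun t x y z => (0, if t is Perp then 0 else x.1 * y.1 * z.1).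

(** Every bracket has first coordinate zero, while a bracket depends only on
    the first coordinates of its arguments, so both sides of each axiom
    vanish. *)
Lemma nilp_tri_leibniz3 (K : fieldType) : is_tri_leibniz3 (@nilp_br K).
Proof.
split; last 5 first.
- by move=> [] *; congr pair; rewrite /= ?mulr0 ?mul0r ?addr0.
- by move=> [] [] *; congr pair; rewrite /= ?mulr0 ?mul0r ?addr0.
- by move=> [] [] *; congr pair; rewrite /= ?mulr0 ?mul0r ?addr0.
- by move=> [] [] *; congr pair; rewrite /= ?mulr0 ?mul0r ?addr0.
- by move=> [] *; congr pair; rewrite /= ?mulr0 ?mul0r ?addr0.
move=> t; split=> y z a u v; congr pair; rewrite /= ?scaler0 ?addr0 //;
  by case: t; rewrite /= ?scaler0 ?addr0 // /GRing.scale /=; ring.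
Qed.

(** Write f = T e = alpha e + beta p.  The fundamental identity for [e,f,-] on
    [f,f,f], multiplied by beta, gives - 2 alpha p = 0, hence f = beta p.  Let
    g = [e,f,e] and let sigma be the coefficient of e in beta g, which is then
    sigma e modulo f.  The identity for [f,f,-] on [e,f,e] gives sigma = 2, and
    that for [e,f,-] on [e,f,f] gives sigma + 1 = 0. *)
Lemma nilp_not_induced (K : fieldType) :
  2%:R != 0 :> K -> 3%:R != 0 :> K -> ~ induced_from_averaging (@nilp_br K).
Proof.
move=> nz2 nz3 [brk [T [[[lb jac] [linT avg]] ind]]].
pose e : (K^o * K^o)%type := (1, 0); pose p : (K^o * K^o)%type := (0, 1).
have dec (u : (K^o * K^o)%type) : u = u.1 *: e + u.2 *: p.
  case: u => u v; congr pair; rewrite /= /GRing.scale /=; ring.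
have scalep (c : K) : c *: p = 0 -> c = 0.
  by move=> /(congr1 snd) /=; rewrite /GRing.scale /= mulr1.
set f := T e; set alpha := f.1; set beta := f.2.
have ffe : brk f f e = p.
  by have /= <- := ind Vdash e e e; congr pair; rewrite /= !mulr1.
have fef : brk f e f = 0.
  by have /= <- := ind Perp e e e.
have eff : brk e f f = p.
  by have /= <- := ind Dashv e e e; congr pair; rewrite /= !mulr1.
have fff : brk f f f = 0.
  by have [_ -> _] := avg e e e; rewrite fef (linear_0 linT).
have betap : beta *: p = f - alpha *: e.
  by rewrite {1}(dec f) addrC addKr.
(* p itself is not a combination of e and f when beta = 0, so each identity
   below is first scaled by beta. *)
have alpha0 : alpha = 0.
  have := jac e f f f f; rewrite eff fff (trilinear_03 lb).
  move=> /(congr1 (GRing.scale beta)); rewrite scaler0 !scalerDr.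
  rewrite -(trilinear_Z1 lb) -(trilinear_Z2 lb) -(trilinear_Z3 lb) betap.
  rewrite -scaleNr (trilinear_D1 lb) (trilinear_D2 lb) (trilinear_D3 lb).
  rewrite (trilinear_Z1 lb) (trilinear_Z2 lb) (trilinear_Z3 lb).
  rewrite fff eff fef ffe scaler0 !add0r addr0 -scalerDl => /esym /scalep /eqP.
  by rewrite -opprD oppr_eq0 -mulr2n -mulr_natl mulf_eq0 (negPf nz2) => /eqP.
rewrite alpha0 scale0r subr0 in betap.
have [g efe] : {g | brk e f e = g} by exists (brk e f e).
pose sigma := beta * g.1.
have betag : beta *: g = sigma *: e + g.2 *: f.
  by rewrite {1}(dec g) scalerDr !scalerA -betap scalerA (mulrC beta g.2).
have sigma2 : sigma = 2%:R.
  have := jac f f e f e; rewrite ffe fff (trilinear_02 lb) addr0 efe.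
  move=> /(congr1 (GRing.scale beta)); rewrite scalerDr.
  rewrite -(trilinear_Z3 lb _ _ _ g) -(trilinear_Z1 lb beta p) -(trilinear_Z3 lb) betap betag.
  rewrite (trilinear_D3 lb) !(trilinear_Z3 lb) ffe eff fff scaler0 addr0.
  move=> /eqP; rewrite -mulr2n -scaler_nat -subr_eq0 -scalerBl => /eqP /scalep.
  by move=> /eqP; rewrite subr_eq0 => /eqP.
have := jac e f e f f; rewrite eff efe => /esym /(canRL (addrK _)).
rewrite subrr => /(congr1 (GRing.scale beta)); rewrite scaler0 scalerDr.
rewrite -(trilinear_Z1 lb) -(trilinear_Z2 lb) betap betag.
rewrite (trilinear_D1 lb) !(trilinear_Z1 lb) eff fff scaler0 addr0 sigma2.
rewrite -{2}[p]scale1r -scalerDl => /scalep /eqP.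
by rewrite -(natrD _ 2 1) (negPf nz3).
Qed.

Theorem mainTheorem7 (K : fieldType) (charK : [pchar K]%R =i pred0) :
  (exists (V : lmodType K) (br : tri_op V),
      is_tri_leibniz3 br /\ ~ induced_from_averaging br) /\
  (forall (V : lmodType K) (br : tri_op V), is_tri_leibniz3 br ->
     [/\ is_leibniz3 (@g3Leib_semidirect_br K V br),
         averaging_operator (@g3Leib_semidirect_br K V br) (@g3Leib_avg K V br),
         is_averaging_leibniz3 (@g3Leib_semidirect_br K V br)
           (@g3Leib_avg K V br) &
         averaging_embedding br (@g3Leib_semidirect_br K V br)
           (@g3Leib_avg K V br) (g3Leib_incl br)]).
Proof.
split=> [|V br hb].
  exists (K^o * K^o)%type, (@nilp_br K); split; first exact: nilp_tri_leibniz3.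
  have /pcharf0P char0 := charK.
  by apply: nilp_not_induced; rewrite char0.
have leib := g3Leib_semidirect_leibniz3 hb.
have avg := g3Leib_averaging hb.
by split=> //; exact: g3Leib_embedding.
Qed.
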